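(* Let $n\ge3$ and let $a^n_\ell$ be the number of fully commutative elements of length $\ell$ in type $\widetilde{A}_{n-1}$. The mean value $\mu_{\widetilde{A}_{n-1}}$ of the ultimately periodic sequence $(a^n_\ell)_{\ell\ge0}$ is equal to $\frac1n\left(\binom{2n}{n}-2\right)$.
   Context: Type $\widetilde{A}_{n-1}$: generators $s_0,\dots,s_{n-1}$, $m_{s_is_{i+1}}=3$ (indices modulo $n$), other pairs of distinct generators commute. An element is fully commutative if any of its reduced expressions can be obtained from any other one using only commutation relations. The mean value of an ultimately periodic sequence is the arithmetic mean of its values over a period (in the periodic part), equivalently the limit of the arithmetic means of its first $k$ values as $k\to\infty$. *)

(* Defs.v *)
From HB Require Import structures.
From Stdlib Require Import Relation_Operators.
From mathcomp Require Import all_boot generic_quotient all_algebra finmap.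
From mathcomp Require Import boolp classical_sets functions cardinality.

Set Implicit Arguments.
Unset Strict Implicit.
Unset Printing Implicit Defensive.

(* The value [0] encodes [m s t = oo] (no relation between [s] and [t]). *)
Record coxeter_matrix (S : finType) := CoxeterMatrix {
  cox_m :> S -> S -> nat;
  cox_m1 : forall s t, (cox_m s t == 1) = (s == t);
  cox_mC : forall s t, cox_m s t = cox_m t s }.

Section CoxeterGroup.
Variables (S : finType) (M : coxeter_matrix S).
Implicit Types (u v w : seq S) (s t : S).

(* Deletion of a factor [(s t)^(m s t)]. Since [m s s = 1], this includes
   [s s = 1]; hence the monoid presented by these relations is the Coxeter
   group, and words need no inverse letters. *)
Inductive cox_step : seq S -> seq S -> Prop :=
| CoxStep u v s t :
    cox_step (u ++ flatten (nseq (M s t) [:: s; t]) ++ v) (u ++ v).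

Definition cox_rel (u v : seq S) : bool :=
  `[< clos_refl_sym_trans _ cox_step u v >].

Lemma cox_rel_refl : reflexive cox_rel.
Proof. by move=> u; apply/asboolP/rst_refl. Qed.

Lemma cox_rel_sym : symmetric cox_rel.
Proof. by move=> u v; apply/asboolP/asboolP; apply: rst_sym. Qed.

Lemma cox_rel_trans : transitive cox_rel.
Proof.
by move=> v u w /asboolP uv /asboolP vw; apply/asboolP/(rst_trans _ _ _ _ _ uv vw).
Qed.

Canonical cox_equiv := EquivRel cox_rel cox_rel_refl cox_rel_sym cox_rel_trans.

Definition coxeter_group := {eq_quot cox_equiv}%qT.
HB.instance Definition _ := EqQuotient.on coxeter_group.
HB.instance Definition _ := Choice.on coxeter_group.

Local Notation W := coxeter_group.

Definition cox_class (u : seq S) : W := (\pi_W u)%qT.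

Lemma cox_relP u v : cox_class u = cox_class v <-> cox_rel u v.
Proof. by split=> [/eqmodP|uv]; last exact/eqmodP. Qed.

Lemma cox_classK (x : W) : cox_class (repr x) = x.
Proof. exact: reprK. Qed.

Lemma cox_classW (P : W -> Prop) : (forall u, P (cox_class u)) -> forall x, P x.
Proof. by move=> Pc x; rewrite -[x]cox_classK. Qed.

Lemma cox_rel_cat u u' v v' : cox_rel u u' -> cox_rel v v' ->
  cox_rel (u ++ v) (u' ++ v').
Proof.
move=> /asboolP uu' /asboolP vv'; apply/asboolP.
apply: (rst_trans _ _ _ (u' ++ v)).
  elim: uu' => {u u'} [_ _ [u1 u2 s t]|u|u u' _ IH|u u' u'' _ IH _ IH'].
  - by rewrite -!catA; apply/rst_step/CoxStep.
  - exact: rst_refl.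
  - exact: rst_sym.
  - exact: rst_trans IH'.
elim: vv' => {v v'} [_ _ [u1 u2 s t]|v|v v' _ IH|v v' v'' _ IH _ IH'].
- by rewrite !(catA u'); apply/rst_step/CoxStep.
- exact: rst_refl.
- exact: rst_sym.
- exact: rst_trans IH'.
Qed.

Lemma cox_rel_sq u s v : cox_rel (u ++ [:: s; s] ++ v) (u ++ v).
Proof.
apply/asboolP/rst_step; have := CoxStep u v s s.
by have /eqP-> : M s s == 1 by rewrite cox_m1.
Qed.

Lemma cox_rel_rev u v : cox_rel u v -> cox_rel (rev u) (rev v).
Proof.
move=> /asboolP uv; elim: uv => {u v} [_ _ [u1 u2 s t]|u|u v _ IH|u v w _ IH _ IH'].
- have -> : rev (u1 ++ flatten (nseq (M s t) [:: s; t]) ++ u2) =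
    rev u2 ++ flatten (nseq (M t s) [:: t; s]) ++ rev u1.
    rewrite !rev_cat -catA cox_mC; congr (_ ++ (_ ++ _)).
    elim: (M t s) => // k IH; rewrite -[in LHS]addn1 nseqD flatten_cat.
    by rewrite rev_cat IH.
  by rewrite rev_cat; apply/asboolP/rst_step/CoxStep.
- exact: cox_rel_refl.
- by rewrite cox_rel_sym.
- exact: cox_rel_trans IH'.
Qed.

Definition cox_one : W := cox_class [::].
Definition cox_mul (x y : W) : W := cox_class (repr x ++ repr y).
Definition cox_inv (x : W) : W := cox_class (rev (repr x)).

Lemma cox_repr u : cox_rel (repr (cox_class u)) u.
Proof. by apply/cox_relP; rewrite cox_classK. Qed.

Lemma cox_mul_class u v : cox_mul (cox_class u) (cox_class v) = cox_class (u ++ v).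
Proof. by apply/cox_relP/cox_rel_cat; apply: cox_repr. Qed.

Lemma cox_inv_class u : cox_inv (cox_class u) = cox_class (rev u).
Proof. exact/cox_relP/cox_rel_rev/cox_repr. Qed.

Lemma cox_mulA : associative cox_mul.
Proof.
elim/cox_classW=> x; elim/cox_classW=> y; elim/cox_classW=> z.
by rewrite (cox_mul_class y) (cox_mul_class x y) !cox_mul_class catA.
Qed.

Lemma cox_1mul : left_id cox_one cox_mul.
Proof. by elim/cox_classW=> x; rewrite cox_mul_class. Qed.

Lemma cox_mul1 : right_id cox_one cox_mul.
Proof. by elim/cox_classW=> x; rewrite cox_mul_class cats0. Qed.

Lemma cox_mulV : right_inverse cox_one cox_inv cox_mul.
Proof.
elim/cox_classW=> x; rewrite cox_inv_class cox_mul_class; apply/cox_relP.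
elim/last_ind: x => [|u s IH]; first exact: cox_rel_refl.
rewrite rev_rcons -cats1 -catA; apply: cox_rel_trans IH.
exact: cox_rel_sq.
Qed.

Lemma cox_Vmul : left_inverse cox_one cox_inv cox_mul.
Proof.
elim/cox_classW=> x; have := cox_mulV (cox_class (rev x)).
by rewrite !cox_inv_class revK cox_mul_class.
Qed.

HB.instance Definition _ := isGroup.Build coxeter_group
  cox_mulA cox_1mul cox_mul1 cox_Vmul cox_mulV.

Definition cox_gen (s : S) : W := cox_class [:: s].

Definition cox_word (v : seq S) : W := (\prod_(s <- v) cox_gen s)%g.

Lemma cox_wordE v : cox_word v = cox_class v.
Proof.
elim: v => [|s v IH]; rewrite /cox_word ?big_nil // big_cons.
by rewrite -/(cox_word v) IH; apply: cox_mul_class.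
Qed.

Lemma cox_word_size_ex (w : W) :
  exists k, `[< exists v, cox_word v = w /\ size v = k >].
Proof.
exists (size (repr w)); apply/asboolP; exists (repr w).
by rewrite cox_wordE cox_classK.
Qed.

Definition cox_length (w : W) : nat := ex_minn (cox_word_size_ex w).

Definition reduced_expr (w : W) (v : seq S) : Prop :=
  cox_word v = w /\ size v = cox_length w.

Inductive comm_step : seq S -> seq S -> Prop :=
| CommStep u v s t : M s t = 2 ->
    comm_step (u ++ [:: s; t] ++ v) (u ++ [:: t; s] ++ v).

Definition fully_commutative (w : W) : Prop :=
  forall v v', reduced_expr w v -> reduced_expr w v' ->
    clos_refl_trans _ comm_step v v'.

Definition fc_elements (l : nat) : set W :=
  [set w | fully_commutative w /\ cox_length w = l]%classic.

(* Ensures that [fset_set] below does not take its default value. *)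
Lemma finite_fc_elements l : finite_set (fc_elements l).
Proof.
apply: (@sub_finite_set _ _ (range (fun v : l.-tuple S => cox_word v))).
  move=> w [_]; rewrite /cox_length; case: ex_minnP => k /asboolP[v [vw vk]] _ kl.
  have vl : size v == l by rewrite vk kl.
  by exists (Tuple vl).
exact/finite_image/finite_finset.
Qed.

Definition fc_count (l : nat) : nat := #|` fset_set (fc_elements l)|%fset.

End CoxeterGroup.

(* The Coxeter matrix of type [A~_(n-1)]; [ordS] is the successor modulo [n].
   Meaningful for [3 <= n] only: in type [A~_1] the off-diagonal entry is oo. *)
Definition affineA_m (n : nat) (i j : 'I_n) : nat :=
  if i == j then 1 else if (j == ordS i) || (i == ordS j) then 3 else 2.

Lemma affineA_m1 n (i j : 'I_n) : (affineA_m i j == 1) = (i == j).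
Proof. by rewrite /affineA_m; case: (i == j) => //; case: (_ || _). Qed.

Lemma affineA_mC n (i j : 'I_n) : affineA_m i j = affineA_m j i.
Proof. by rewrite /affineA_m eq_sym orbC. Qed.

Definition affineA (n : nat) : coxeter_matrix 'I_n :=
  CoxeterMatrix (@affineA_m1 n) (@affineA_mC n).

Definition periodic_from (a : nat -> nat) (N p : nat) : Prop :=
  0 < p /\ forall l, N <= l -> a (l + p) = a l.

Definition ultimately_periodic (a : nat -> nat) : Prop :=
  exists N p, periodic_from a N p.

Definition has_mean_value (a : nat -> nat) (mu : rat) : Prop :=
  ultimately_periodic a /\
  forall N p, periodic_from a N p ->
    ((\sum_(N <= l < N + p) a l)%N%:R / p%:R = mu)%R.

(* Main.v *)
Require Import Defs.
From Stdlib Require Import Relation_Operators.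
From mathcomp Require Import all_boot all_algebra finmap perm zify boolp.

Set Implicit Arguments.
Unset Strict Implicit.
Unset Printing Implicit Defensive.

(** Fully commutative elements are particle histories.  Put particles on the
ring Z/n, at most one per site, and let the letter a move a particle from a to
an empty site a - 1.  A word is legal from a set o of occupied sites if all its
moves can be carried out in turn.  Letters at distance at least 2 move
independently of each other, and between two moves a the letters a - 1 and a + 1
both have to occur: so no word obtained from a legal word by
commutations contains s s or s t s with m(s,t) = 3, and the group element of a
legal word is fully commutative.  Conversely, every reduced word of a fully
commutative element is legal (fc_word_legal_ex).  The point is that between two
consecutive letters a there must be at least two letters a - 1 or a + 1, and
then exactly one of each: two letters a + 1 with no a between them would again
be a pair of consecutive equal letters, closer to each other and not of this
shape.

To pass from words to group elements one needs that two words for the same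
element, one of which admits no such factors up to commutation, are related by
commutations as soon as the other is not longer (fc_word_unique).  This is
derived from the exchange property, which itself comes from the invariance
modulo 2 of the multiset of reflections attached to a word (odd_reflections).

Counting is now easy.  When the length l is large, every letter occurs in a
legal word; its first occurrences determine the initial set o
(legal_start_uniq), and o, the final set f and l determine the word up to
commutation (legal_same_ends), because the balance of moves at each site gives
the numbers of occurrences of the letters up to a common additive constant.
Moves preserve the number of particles, and each of them lowers the sum of the
positions by 1 modulo n.  Conversely, if o is neither empty nor full, f has as
many sites as o, and l is congruent to the difference of the two sums of
positions, then a legal word of length l leads from o to f (legal_of_length).
Hence for large l the fully commutative elements of length l are in bijection
with the pairs (o, f) with 0 < |o| = |f| < n lying in one residue class modulo n
that depends on l.  As l runs over n consecutive values each pair is counted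
exactly once, and by Vandermonde's identity there are 'C(2n, n) - 2 pairs. *)

(** * Reflections and the exchange property *)

Lemma first_occurrence (T : eqType) (x : T) (l : seq T) : x \in l ->
  exists p q : seq T, l = p ++ x :: q /\ x \notin p.
Proof.
move=> xl; exists (take (index x l) l), (drop (index x l).+1 l).
rewrite -{2}(nth_index x xl) -drop_nth ?index_mem // cat_take_drop; split=> //.
by rewrite in_take ?ltnn // index_mem.
Qed.

Section Coxeter.
Variables (S : finType) (M : coxeter_matrix S).
Implicit Types (u v w p q : seq S) (s t : S).

Local Notation W := (coxeter_group M).
Local Notation gen := (@cox_gen S M).
Local Notation word := (@cox_word S M).
Local Notation len := (@cox_length S M).

Local Open Scope group_scope.

Lemma cox_word_nil : word [::] = 1.
Proof. by rewrite /cox_word big_nil. Qed.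

Lemma cox_word_cons s v : word (s :: v) = gen s * word v.
Proof. by rewrite /cox_word big_cons. Qed.

Lemma cox_word_cat u v : word (u ++ v) = word u * word v.
Proof. by rewrite /cox_word big_cat. Qed.

Definition cox_wordS := (cox_word_cons, cox_word_cat, cox_word_nil).

Lemma cox_word_step u v : cox_step M u v -> word u = word v.
Proof.
by move=> uv; rewrite !cox_wordE; apply/cox_relP/asboolP/rst_step.
Qed.

Lemma cox_word_braid s t : word (flatten (nseq (M s t) [:: s; t])) = 1.
Proof.
rewrite -cox_word_nil; apply: cox_word_step.
by have := CoxStep M [::] [::] s t; rewrite cats0.
Qed.

Lemma cox_gen_sq s : gen s * gen s = 1.
Proof.
have := cox_word_braid s s.
have /eqP-> : M s s == 1%N by rewrite cox_m1.
by rewrite /= !cox_wordS mulg1.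
Qed.

Lemma cox_genK s (x : W) : gen s * (gen s * x) = x.
Proof. by rewrite mulgA cox_gen_sq mul1g. Qed.

Lemma cox_genV s : (gen s)^-1 = gen s.
Proof. by apply: (mulgI (gen s)); rewrite mulgV cox_gen_sq. Qed.

Lemma cox_gen_comm s t : M s t = 2 -> gen s * gen t = gen t * gen s.
Proof.
rewrite cox_mC => ts; have := cox_word_braid t s.
rewrite ts /= !cox_wordS mulg1 => e.
by apply: (mulgI (gen s)); apply: (mulgI (gen t)); rewrite e cox_genK cox_gen_sq.
Qed.

Lemma cox_gen_braid s t :
  M s t = 3 -> gen s * (gen t * gen s) = gen t * (gen s * gen t).
Proof.
rewrite cox_mC => ts; have := cox_word_braid t s.
rewrite ts /= !cox_wordS mulg1 => e.
apply: (mulgI (gen s)); apply: (mulgI (gen t)); apply: (mulgI (gen s)).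
apply: (mulgI (gen t)).
rewrite !cox_genK cox_gen_sq mulg1 -[LHS]mul1g -e -!mulgA.
by [].
Qed.

Lemma cox_length_word v : len (word v) <= size v.
Proof.
by rewrite /cox_length; case: ex_minnP => k _; apply; apply/asboolP; exists v.
Qed.

Lemma cox_reduced_ex (x : W) : exists v, word v = x /\ size v = len x.
Proof. by rewrite /cox_length; case: ex_minnP => k /asboolP. Qed.

Definition reduced v := size v = len (word v).

Lemma reduced_prefix u v : reduced (u ++ v) -> reduced u.
Proof.
move=> r; apply/eqP; rewrite eqn_leq cox_length_word andbT.
have [u' [eu <-]] := cox_reduced_ex (word u).
have := cox_length_word (u' ++ v); rewrite cox_word_cat eu -cox_word_cat -r.
by rewrite !size_cat leq_add2r.
Qed.

(** For v = s_1 ... s_k these are the reflections s_1 ... s_i ... s_1.  The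
letter s_i can be deleted from v by multiplying by its reflection on the left. *)
Fixpoint reflections v : seq W :=
  if v is s :: v' then gen s :: [seq gen s * r * gen s | r <- reflections v']
  else [::].

Lemma reflections_cat u v : reflections (u ++ v) =
  reflections u ++ [seq word u * r * (word u)^-1 | r <- reflections v].
Proof.
elim: u => [|s u IH] /=.
  rewrite cox_word_nil -[LHS]map_id; apply: eq_map => r.
  by rewrite mul1g invg1 mulg1.
rewrite IH map_cat -map_comp; congr (_ :: _ ++ _); apply: eq_map => r /=.
by rewrite cox_word_cons invgM cox_genV !mulgA.
Qed.

Lemma count_conj (x r : W) (l : seq W) :
  count_mem r [seq x * y * x^-1 | y <- l] = count_mem (x^-1 * r * x) l.
Proof.
rewrite count_map; apply: eq_count => y /=.
apply/eqP/eqP => [<-|->]; first by rewrite !mulgA mulgVK mulVg mul1g.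
by rewrite !mulgA mulgV mul1g mulgK.
Qed.

(** The reflections of s t s t ... are the alternating words of odd length in s
and t, written here as powers of the rotation s t times s. *)
Lemma reflections_dihedral s t k :
  reflections (flatten (nseq k [:: s; t])) =
  mkseq (fun i => (gen s * gen t) ^+ i * gen s) k.*2.
Proof.
elim: k => // k IH.
rewrite /= IH /mkseq doubleS /= -!map_comp (iotaDl 2 0) -map_comp.
rewrite expg0 mul1g expg1; congr [:: _, _ & _].
apply: eq_map => i /=; rewrite (addnC 2) expgnDr expg2.
have c : commute ((gen s * gen t) ^+ i) (gen s * gen t).
  exact/commute_sym/commuteX/commute_refl.
by rewrite [X in _ = X * _]mulgA c !mulgA.
Qed.

(** The relation (s t)^m = 1 makes the list of the 2m reflections of its word
repeat itself after m entries. *)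
Lemma odd_reflections_braid s t r :
  ~~ odd (count_mem r (reflections (flatten (nseq (M s t) [:: s; t])))).
Proof.
rewrite reflections_dihedral.
have pow1 : (gen s * gen t) ^+ (M s t) = 1.
  rewrite -(cox_word_braid s t); elim: (M s t) => [|k IH].
    by rewrite expg0 cox_word_nil.
  by rewrite expgS IH /= !cox_wordS mulgA.
have shift (f : nat -> W) : (forall i, f (M s t + i) = f i) ->
    map f (iota (M s t) (M s t)) = map f (iota 0 (M s t)).
  move=> per; rewrite -{1}(addn0 (M s t)) iotaDl -map_comp.
  by apply: eq_map => i /=; rewrite per.
rewrite -addnn /mkseq iotaD map_cat add0n shift => [|i].
  by rewrite count_cat addnn odd_double.
by rewrite expgnDr pow1 mul1g.
Qed.

(** Inserting a relator contributes an even number of copies of each reflection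
and, being trivial in the group, does not conjugate the reflections of the
letters that follow. *)
Lemma odd_reflections u v r : word u = word v ->
  odd (count_mem r (reflections u)) = odd (count_mem r (reflections v)).
Proof.
rewrite !cox_wordE => /cox_relP /asboolP uv.
elim: uv r => {u v} [_ _ [p q s t]|//|u v _ IH|u v w _ IH _ IH'] r.
- rewrite !reflections_cat !map_cat !count_cat !oddD !count_conj.
  rewrite (negPf (odd_reflections_braid _ _ _)) /=.
  by rewrite cox_word_braid invg1 mul1g mulg1.
- by rewrite IH.
- by rewrite IH.
Qed.

Lemma mem_reflections s v : gen s \in reflections v ->
  exists p x q, v = p ++ x :: q /\ gen s * word p = word p * gen x.
Proof.
suff gen_case (r : W) : r \in reflections v ->
    exists p x q, v = p ++ x :: q /\ r * word p = word p * gen x by exact: gen_case.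
elim: v r => // t v IH r; rewrite inE.
case/predU1P=> [->|/mapP[r' /IH[p [x [q [-> e]]]] ->]].
  by exists [::], t, v; rewrite cox_word_nil mulg1 mul1g.
exists (t :: p), x, q; split=> //.
by rewrite cox_word_cons -!mulgA cox_genK e.
Qed.

(** If gen s were not among the reflections of v, it would occur an odd number
of times, namely once, among those of s :: v, hence also among those of a
shortest word u of the same element.  Deleting a letter of u would then give a
word of [word v] shorter than v. *)
Lemma exchange s v : reduced v -> len (gen s * word v) <= size v ->
  exists p x q, v = p ++ x :: q /\ gen s * word p = word p * gen x.
Proof.
move=> rv; have [u [eu su]] := cox_reduced_ex (gen s * word v) => le.
case: (boolP (gen s \in reflections v)) => [/mem_reflections //|nv].
have odd_u : odd (count_mem (gen s) (reflections u)).
  rewrite (@odd_reflections u (s :: v)) ?cox_word_cons //= eqxx.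
  have := count_conj (gen s) (gen s) (reflections v).
  by rewrite cox_genV cox_gen_sq mul1g => ->; rewrite (count_memPn nv).
have : gen s \in reflections u.
  by rewrite -has_pred1 has_count; case: (count _ _) odd_u.
case/mem_reflections => p [x [q [def_u e]]].
have : word v = word (p ++ q).
  rewrite -[LHS](cox_genK s) -eu def_u !cox_wordS mulgA e.
  by rewrite -!mulgA cox_genK.
move=> ev; have := cox_length_word (p ++ q); rewrite -ev -rv.
by move: le; rewrite -su def_u !size_cat /=; lia.
Qed.

(** * Commutation classes of fully commutative words *)

Definition comm u v : Prop := clos_refl_trans _ (comm_step M) u v.

Lemma comm_refl u : comm u u. Proof. exact: rt_refl. Qed.

Lemma comm_trans v u w : comm u v -> comm v w -> comm u w.
Proof. exact: rt_trans. Qed.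

Lemma comm_sym u v : comm u v -> comm v u.
Proof.
elim=> {u v} [_ _ [p q s t st]|u|u v w _ vu _ wv].
- by apply: rt_step; apply: CommStep; rewrite cox_mC.
- exact: comm_refl.
- exact: comm_trans wv vu.
Qed.

Lemma comm_cat u u' v v' : comm u u' -> comm v v' -> comm (u ++ v) (u' ++ v').
Proof.
move=> uu' vv'; apply: (@comm_trans (u' ++ v)).
  elim: uu' => {u u'} [_ _ [p q s t st]|u|u u' u'' _ IH _ IH'].
  - by rewrite -!catA; apply/rt_step/CommStep.
  - exact: comm_refl.
  - exact: comm_trans IH IH'.
elim: vv' => {v v'} [_ _ [p q s t st]|v|v v' v'' _ IH _ IH'].
- by rewrite !(catA u'); apply/rt_step/CommStep.
- exact: comm_refl.
- exact: comm_trans IH IH'.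
Qed.

Lemma comm_cons s u v : comm u v -> comm (s :: u) (s :: v).
Proof. exact: comm_cat (comm_refl [:: s]). Qed.

Lemma comm_swap s t v : M s t = 2 -> comm [:: s, t & v] [:: t, s & v].
Proof. by move=> st; apply/rt_step/(CommStep [::]). Qed.

Lemma comm_perm u v : comm u v -> perm_eq u v.
Proof.
elim=> {u v} [_ _ [p q s t st]|//|u v w _ uv _]; last exact: perm_trans.
by rewrite perm_cat2l (perm_catCA [:: s] [:: t]).
Qed.

Lemma comm_size u v : comm u v -> size u = size v.
Proof. by move/comm_perm/perm_size. Qed.

Lemma comm_word u v : comm u v -> word u = word v.
Proof.
elim=> {u v} [_ _ [p q s t st]|//|u v w _ -> _ //].
by rewrite !cox_wordS !mulg1 (cox_gen_comm st).
Qed.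

Lemma comm_move s p : {in p, forall t, M s t = 2} -> comm (s :: p) (rcons p s).
Proof.
elim: p => [_|t p IH st]; first exact: comm_refl.
apply: comm_trans (comm_swap _ _) _; first by apply: st; rewrite mem_head.
by apply/comm_cons/IH => r pr; apply: st; rewrite inE pr orbT.
Qed.

(** A word whose commutation class offers no place to cancel a square or to apply
a braid relation of length 3; in a simply laced group these are the reduced
words of the fully commutative elements. *)
Definition fc_word v : Prop := forall u p q s, comm v u ->
  u <> p ++ [:: s; s] ++ q /\
  forall t, M s t = 3 -> u <> p ++ [:: s; t; s] ++ q.

Lemma fc_word_comm u v : comm u v -> fc_word u -> fc_word v.
Proof. by move=> uv fu w p q s vw; apply: fu; apply: comm_trans vw. Qed.

Lemma fc_word_factor a v b : fc_word (a ++ v ++ b) -> fc_word v.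
Proof.
move=> fv u p q s vu.
have [|nsq nbr] := fv (a ++ u ++ b) (a ++ p) (q ++ b) s.
  by apply: comm_cat (comm_refl _) (comm_cat vu (comm_refl _)).
split=> [def_u|t st def_u]; [apply: nsq | apply: (nbr t st)];
  by rewrite def_u -!catA.
Qed.

Lemma fc_word_suffix u v : fc_word (u ++ v) -> fc_word v.
Proof. by rewrite -[v]cats0 => /fc_word_factor; rewrite cats0. Qed.

Lemma fc_word_prefix u v : fc_word (u ++ v) -> fc_word u.
Proof. exact: (@fc_word_factor [::]). Qed.

(** A square would shorten the word.  A braid relation would give another reduced
word, and the two could not be related by commutations, since they do not have
the same number of letters s. *)
Lemma fc_word_of_reduced (x : W) v : fully_commutative x -> reduced_expr x v ->
  fc_word v.
Proof.
move=> fcx [vx sv] u p q s vu.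
have rx : reduced_expr x u by rewrite /reduced_expr -(comm_word vu) -(comm_size vu).
split=> [|t st] def_u; rewrite {u}def_u in rx vu.
  have := cox_length_word (p ++ q).
  have <- : word (p ++ [:: s; s] ++ q) = word (p ++ q).
    by rewrite !cox_wordS mulg1 cox_gen_sq mul1g.
  by case: rx => -> <-; rewrite !size_cat /=; lia.
have : comm (p ++ [:: s; t; s] ++ q) (p ++ [:: t; s; t] ++ q).
  apply: (fcx _ _ rx); case: rx => ex sx; split; last by rewrite -sx !size_cat.
  by rewrite -ex !cox_wordS !mulg1 (cox_gen_braid st).
move/comm_perm/seq.permP/(_ (pred1 s)); rewrite !count_cat /= eqxx.
suff /negPf-> : t != s by lia.
by rewrite eq_sym -(cox_m1 M) st.
Qed.

Hypothesis simply_laced : forall s t, s != t -> M s t = 2 \/ M s t = 3.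

(** With no neighbour of a between two consecutive letters a, these two can be
brought together; with a single neighbour b, they can both be brought next to b,
which gives a b a. *)
Lemma fc_word_gap p a m q : fc_word (p ++ a :: m ++ a :: q) -> a \notin m ->
  1 < count [pred b | M a b == 3] m.
Proof.
set far := [pred b | M a b == 3] => fv am; rewrite ltnNge; apply/negP => le1.
have {fv} fv : fc_word (rcons (a :: m) a).
  by apply: (@fc_word_factor p _ q); rewrite /= cat_rcons.
have slide r : {subset r <= m} -> ~~ has far r -> comm (a :: r) (rcons r a).
  move=> rm /hasPn nr; apply: comm_move => b br.
  have nab : a != b by apply: contra am => /eqP->; apply: rm.
  have [//|ab] := simply_laced nab.
  by have := nr b br; rewrite /= ab.
have [hm|/slide nm] := boolP (has far m); last first.
  have vaa : comm (rcons (a :: m) a) (rcons (rcons m a) a).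
    by rewrite -!cats1; apply: comm_cat (comm_refl _); rewrite cats1; apply: nm.
  have [+ _] := fv _ m [::] a vaa.
  by rewrite -!cats1 -catA.
move: le1 slide fv am; case/split_find: hm => b m1 m2 Mab m1far.
rewrite cat_rcons count_cat /= -[M a b == 3]/(far b) Mab => le1 slide fv am.
have m2far : ~~ has far m2.
  by rewrite has_count; move: le1; case: (count _ m2) => //; lia.
have sub1 : {subset m1 <= m1 ++ b :: m2} by move=> x xm; rewrite mem_cat xm.
have sub2 : {subset m2 <= m1 ++ b :: m2}.
  by move=> x xm; rewrite mem_cat inE xm !orbT.
suff aba : comm (rcons (a :: m1 ++ b :: m2) a) (m1 ++ [:: a; b; a] ++ m2).
  have [_ nbr] := fv _ m1 m2 a aba.
  exact: (nbr b (eqP Mab)).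
rewrite -[X in comm _ X](_ : rcons m1 a ++ ([:: b] ++ (a :: m2)) = _).
  rewrite /= rcons_cat rcons_cons -cat_cons; apply: comm_cat; first exact: slide.
  exact/comm_cons/comm_sym/slide.
by rewrite cat_rcons.
Qed.

Hypothesis gen_inj : injective gen.

(** If s and t commuted, the braid relation s t s = t s t would reduce to s = t. *)
Lemma gen_comm_eq s t : M s t = 3 -> gen s * gen t = gen t * gen s -> s = t.
Proof.
move=> st c; apply: gen_inj; have := cox_gen_braid st.
by rewrite c cox_genK -c cox_genK.
Qed.

(** By induction on the length of v.  The exchange property, applied to v and the
first letter s of u, moves some letter x of v to the front, where it becomes s:
v = p x q and s p = p x in the group.  It remains to see that s p and p x are
related by commutations.  If t is the first letter of p, this follows by
induction when s = t or when s and t commute.  When m(s,t) = 3 both s and t are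
left descents of the element of p x; a further exchange then makes p x
equivalent to a word beginning with t s t, which is impossible. *)
Lemma fc_word_unique v u : fc_word v -> word u = word v -> size u <= size v ->
  comm u v.
Proof.
have [k] := ubnP (size v); elim: k v u => // k IH v u vk fv uv.
case: v => [|t v] in vk fv uv *.
  by case: u uv => // _ _; apply: comm_refl.
have red_of w : size w <= size v -> fc_word w -> reduced w.
  move=> wv fw; have [w' [ew sw]] := cox_reduced_ex (word w).
  have w'w : size w' <= size w by rewrite sw cox_length_word.
  rewrite /reduced -sw -(comm_size (IH _ _ _ fw ew w'w)) //.
  by move: vk wv => /=; lia.
have fv' : fc_word v by apply: (@fc_word_suffix [:: t]).
have red_v : reduced (t :: v).
  apply/eqP; rewrite eqn_leq cox_length_word andbT leqNgt; apply/negP => lt.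
  have := @exchange t v (red_of _ (leqnn _) fv').
  rewrite -cox_word_cons => /(_ lt)[p [x [q [def_v e]]]].
  have tpq : comm (t :: p ++ q) v.
    apply: IH; rewrite // def_v.
      by rewrite !cox_wordS mulgA e -mulgA.
    by rewrite /= !size_cat /= addnS.
  have [+ _] := fv [:: t, t & p ++ q] [::] (p ++ q) t (comm_cons t (comm_sym tpq)).
  by [].
move=> le_uv; have {le_uv} size_u : size u = (size v).+1.
  by apply/eqP; rewrite eqn_leq le_uv; have := cox_length_word u; rewrite uv -red_v.
case: u => [//|s u] in uv size_u *; case: size_u => size_u.
have [p [x [q [def_v e]]]]:
    exists p x q, t :: v = p ++ x :: q /\ gen s * word p = word p * gen x.
  apply: exchange => //; rewrite -uv cox_word_cons cox_genK /= -size_u.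
  exact: leqW (cox_length_word _).
have eu : word u = word (p ++ q).
  rewrite -[LHS](cox_genK s) -cox_word_cons uv def_v !cox_wordS mulgA e.
  by rewrite -!mulgA cox_genK.
(* The tail p q inherits the property of v only once s p q is commutation
   equivalent to v, so this equivalence is obtained first. *)
suff spq : comm (s :: p ++ q) (t :: v).
  apply: comm_trans (spq); apply: comm_cons; apply: IH => //.
  - by have := comm_size spq; move: vk => /= + [->].
  - apply: (@fc_word_suffix [:: s]); apply: fc_word_comm fv; exact: comm_sym.
  - by rewrite size_u; have := comm_size spq => /= -[->].
suff spx : comm (s :: p) (rcons p x).
  by rewrite def_v -cat_rcons -cat_cons; apply: comm_cat spx (comm_refl q).
clear eu; case: p => [|t' p] in def_v e *.
  by move: e; rewrite cox_word_nil mulg1 mul1g => /gen_inj->; apply: comm_refl.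
case: def_v => ? def_v; subst t'.
move: fv vk red_v; rewrite def_v -cat_rcons -cat_cons => fv vk red_v.
have {fv} fpx : fc_word (t :: rcons p x) by apply: fc_word_prefix fv.
have {red_v} red_px : reduced (t :: rcons p x) by apply: reduced_prefix red_v.
have {vk} pk : (size p).+2 <= k.
  by move: vk; rewrite /= size_cat size_rcons; lia.
have fpx' : fc_word (rcons p x) by apply: (@fc_word_suffix [:: t]).
have ewpx w : word w = word (rcons p x) -> size w = (size p).+1 ->
    comm w (rcons p x).
  by move=> ew sw; apply: IH; rewrite ?size_rcons ?sw.
move: e; rewrite cox_word_cons -mulgA => e.
have ex : gen t * (gen s * (gen t * word p)) = word p * gen x.
  by rewrite e cox_genK.
have [ts|nts] := eqVneq t s.
  subst t; apply: comm_cons; apply: ewpx => //.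
  by rewrite -cats1 !cox_wordS mulg1 -ex cox_genK.
have [st2|st3] := simply_laced nts.
  apply: (@comm_trans [:: t, s & p]).
    by apply: comm_swap; rewrite cox_mC.
  apply: comm_cons; apply: ewpx => //.
  rewrite -cats1 !cox_wordS mulg1 -ex.
  by rewrite (mulgA (gen s)) -(cox_gen_comm st2) -(mulgA (gen t)) cox_genK.
have st3' : M s t = 3 by rewrite cox_mC.
exfalso.
(* The word s t p is reduced too, and t is a left descent of its element. *)
have red_stp : reduced [:: s, t & p].
  move: red_px; rewrite /reduced /= size_rcons => ->.
  by rewrite -cats1 !cox_wordS mulg1 -e.
have [||a [y [b [def_stp ey]]]] := @exchange t [:: s, t & p] => //.
  have -> : gen t * word [:: s, t & p] = word (rcons p x).
    by rewrite -cats1 !cox_wordS mulg1 -ex.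
  by apply: leq_trans (cox_length_word _) _; rewrite size_rcons.
case: a => [|s' a] in def_stp ey *.
  move: ey def_stp; rewrite cox_word_nil mulg1 mul1g => /gen_inj ty [] ys _.
  by move: nts; rewrite ty ys eqxx.
case: def_stp => ? def_stp; subst s'.
case: a => [|t' a] in def_stp ey *.
  case: def_stp => ? _; subst y; move: ey; rewrite !cox_wordS mulg1.
  by move/(gen_comm_eq st3)/eqP; rewrite (negPf nts).
case: def_stp => ? def_p; subst t'.
have ep : word p = gen s * word (a ++ b).
  apply: (mulgI (gen t)); apply: (mulgI (gen s)).
  transitivity (gen s * (gen t * word a) * gen y * word b).
    by rewrite def_p !cox_wordS !mulgA.
  move: ey; rewrite !cox_wordS => <-.
  by have := cox_gen_braid st3'; rewrite !mulgA => ->.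
(* Now t p x is equivalent to t s t a b: a braid. *)
have tst : comm (t :: [:: s, t & a ++ b]) (t :: rcons p x).
  apply/comm_cons/ewpx; last by rewrite def_p /= !size_cat /= addnS.
  rewrite -cats1 cox_word_cat [word [:: x]]cox_word_cons cox_word_nil mulg1.
  rewrite -ex ep !cox_wordS.
  have := cox_gen_braid st3; rewrite !mulgA => ->.
  by rewrite -!mulgA cox_genK.
have [_ nbr] := fpx _ [::] (a ++ b) t (comm_sym tst).
exact: (nbr s st3).
Qed.

Lemma fc_word_length v : fc_word v -> len (word v) = size v.
Proof.
move=> fv; have [u [uv su]] := cox_reduced_ex (word v).
rewrite -su; apply: comm_size; apply/comm_sym/comm_sym/(fc_word_unique fv uv).
by rewrite su cox_length_word.
Qed.

Lemma fc_word_fc v : fc_word v -> fully_commutative (word v).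
Proof.
move=> fv u u' [uv su] [u'v su'].
have vsize := fc_word_length fv.
apply: (@comm_trans v).
  by apply: fc_word_unique; rewrite // su vsize.
by apply: comm_sym; apply: fc_word_unique; rewrite // su' vsize.
Qed.

End Coxeter.

(** * The Coxeter matrix of the cycle *)

Section Affine.
Variables (n : nat) (hn : 2 < n).
Implicit Types (i j s t a : 'I_n).
Local Notation M := (affineA n).

Lemma val_ordS i : ordS i = (if i.+1 == n then 0 else i.+1) :> nat.
Proof.
rewrite /=; case: eqP => [->|/eqP ne]; first by rewrite modnn.
by rewrite modn_small // ltn_neqAle ne ltn_ord.
Qed.

Lemma ordS_neq i : ordS i != i.
Proof.
rewrite -(inj_eq (@ord_inj n)) val_ordS.
by case: (i.+1 =P n) => [e|_]; lia.
Qed.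

Lemma ordSS_neq i : ordS (ordS i) != i.
Proof.
rewrite -(inj_eq (@ord_inj n)) val_ordS; case: (_ =P n); rewrite val_ordS.
  by case: (i.+1 =P n) => [e|_]; lia.
by case: (i.+1 =P n) => [e|_]; lia.
Qed.

Lemma ord_pred_neq i : ord_pred i != i.
Proof. by rewrite -{2}[i]ord_predK eq_sym ordS_neq. Qed.

Lemma eq_ord_pred i j : (i == ord_pred j) = (ordS i == j).
Proof. exact: esym (can2_eq (@ordSK n) (@ord_predK n) _ _). Qed.

Lemma affineA_simply_laced s t : s != t -> M s t = 2 \/ M s t = 3.
Proof.
by rewrite /= /affineA_m => /negPf->; case: ifP; [right | left].
Qed.

Lemma affineA_comm_neq s t : M s t = 2 -> [/\ s != t, t != ordS s & s != ordS t].
Proof.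
by rewrite /= /affineA_m; case: eqP => //; case: eqP => //=; case: eqP.
Qed.

Lemma affineA_neq_comm s t :
  s != t -> t != ordS s -> s != ordS t -> M s t = 2.
Proof. by rewrite /= /affineA_m => /negPf-> /negPf-> /negPf->. Qed.

Lemma affineA_braid s t : M s t = 3 -> t = ordS s \/ s = ordS t.
Proof.
rewrite /= /affineA_m; case: eqP => //; case: eqP => [|_] //=; first by left.
by case: eqP => //; right.
Qed.

Local Open Scope group_scope.

Local Notation swap i := (tperm i (ordS i)).

(** The transpositions of i and i + 1, with indices modulo n, satisfy the defining
relations; the resulting permutation action separates the generators. *)
Lemma swap_braid s :
  swap s * swap (ordS s) * swap s = swap (ordS s) * swap s * swap (ordS s).
Proof.
have conj x y : swap x * swap y * swap x = swap y ^ swap x.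
  by rewrite conjgE tpermV mulgA.
have s_up : swap s (ordS (ordS s)) = ordS (ordS s).
  by rewrite tpermD // eq_sym ?ordSS_neq ?ordS_neq.
have up_s : swap (ordS s) s = s by rewrite tpermD // ?ordSS_neq ?ordS_neq.
by rewrite !conj !tpermJ s_up up_s tpermR tpermL.
Qed.

Lemma swap_rel s t : (swap s * swap t) ^+ M s t = 1.
Proof.
have [<-|nst] := eqVneq s t.
  have /eqP-> : M s s == 1%N by rewrite cox_m1.
  by rewrite expg1 tperm2.
have [st|st] := affineA_simply_laced nst; rewrite st.
  have [_ ts ts'] := affineA_comm_neq st.
  have c : commute (swap s) (swap t).
    apply/commgP/conjg_fixP.
    by rewrite tpermJ !tpermD // ?(inj_eq (@ordS_inj n)) //; rewrite eq_sym.
  by rewrite expgMn // !expg2 !tperm2 mulg1.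
have cube (x y : {perm 'I_n}) : x * x = 1 -> y * y = 1 ->
    x * y * x = y * x * y -> (x * y) ^+ 3 = 1.
  move=> xx yy e; rewrite !expgS expg0 mulg1 !mulgA e.
  by rewrite -(mulgA (y * x)) yy mulg1 -(mulgA y) xx mulg1 yy.
by apply: cube; rewrite ?tperm2 //; case: (affineA_braid st) => ->;
  rewrite swap_braid.
Qed.

Lemma affineA_gen_inj : injective (@cox_gen _ M).
Proof.
move=> s t /(iffLR (cox_relP _ _ _))/asboolP st.
pose perm_word (v : seq 'I_n) : {perm 'I_n} := \prod_(i <- v) swap i.
have : perm_word [:: s] = perm_word [:: t].
  elim: st => {s t} [_ _ [p q s t]|//|u v _ -> //|u v w _ -> _ -> //].
  have perm_pow k : perm_word (flatten (nseq k [:: s; t])) = (swap s * swap t) ^+ k.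
    rewrite /perm_word; elim: k => [|k IH]; first by rewrite big_nil.
    by rewrite /= !big_cons IH mulgA expgS.
  have perm_cat u v : perm_word (u ++ v) = perm_word u * perm_word v.
    exact: big_cat.
  by rewrite !perm_cat perm_pow swap_rel mul1g.
rewrite /perm_word !big_seq1 => /permP/(_ s); rewrite tpermL.
have [//|nst] := eqVneq s t.
case: tpermP => [e|e|_ _] /eqP.
- by rewrite e eqxx in nst.
- by rewrite e (negPf (ordSS_neq t)).
- by rewrite (negPf (ordS_neq s)).
Qed.

End Affine.

(** * Particles on a ring *)

Section Particles.
Variables (n : nat) (hn : 2 < n).
Implicit Types (i j s t a : 'I_n) (o f : {set 'I_n}) (u v w : seq 'I_n).
Local Notation M := (affineA n).
Local Notation comm := (@comm _ M).
Local Notation fc_word := (@fc_word _ M).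
Local Notation pred := ord_pred.

Definition fireable o a := (a \in o) && (pred a \notin o).

Definition fire o a := pred a |: o :\ a.

Fixpoint legal o v :=
  if v is a :: v' then fireable o a && legal (fire o a) v' else true.

Definition final o v := foldl fire o v.

Lemma in_fire o a i :
  (i \in fire o a) = (ordS i == a) || (i != a) && (i \in o).
Proof. by rewrite !inE eq_ord_pred. Qed.

Lemma legal_cat o u v : legal o (u ++ v) = legal o u && legal (final o u) v.
Proof. by elim: u o => //= a u IH o; rewrite IH andbA. Qed.

Lemma final_cat o u v : final o (u ++ v) = final (final o u) v.
Proof. by rewrite /final foldl_cat. Qed.

(** A site i is emptied by the letter i and filled by the letter i + 1, so both
sides compare what enters the site with what leaves it. *)
Lemma legal_flux o v i : legal o v ->
  (i \in o) + count_mem (ordS i) v = (i \in final o v) + count_mem i v.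
Proof.
elim: v o => //= a v IH o /andP[/andP[ao pao] /IH].
rewrite in_fire (eq_sym a) (eq_sym a i).
have [e|_] := eqVneq (ordS i) a => /=.
  move: pao; rewrite -e ordSK => /negPf->.
  by rewrite [i == _]eq_sym (negPf (ordS_neq hn i)) /=; lia.
by have [->|_] := eqVneq i a; rewrite /= ?ao !add0n => ->; rewrite // addnCA.
Qed.

(** Each move lowers this sum by 1 modulo n, which ties the length of a legal word
to its two end states. *)
Definition position_sum o := \sum_(i in o) i.

Lemma card_fire o a : fireable o a -> #|fire o a| = #|o|.
Proof.
case/andP=> ao pao; rewrite cardsU1 !inE (negPf pao) andbF /=.
by rewrite (cardsD1 a o) ao.
Qed.

Lemma position_sum_fire o a : fireable o a ->
  1 + position_sum (fire o a) = position_sum o %[mod n].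
Proof.
case/andP=> ao pao; rewrite /position_sum big_setU1 ?inE ?(negPf pao) ?andbF //=.
rewrite [in RHS](big_setD1 a) //= addnA -modnDml; congr (_ %% n).
congr (_ + _); rewrite -{2}[a]ord_predK /=; congr (_ %% n).
Qed.

Lemma legal_card o v : legal o v -> #|final o v| = #|o|.
Proof.
by elim: v o => //= a v IH o /andP[fa /IH ->]; rewrite card_fire.
Qed.

Lemma legal_position_sum o v : legal o v ->
  size v + position_sum (final o v) = position_sum o %[mod n].
Proof.
elim: v o => //= a v IH o /andP[fa /IH e].
by rewrite -add1n -addnA -modnDmr e modnDmr position_sum_fire.
Qed.

Lemma legal_comm u v o : comm u v -> legal o u ->
  legal o v /\ final o v = final o u.
Proof.
move=> uv; elim: uv o => {u v}
  [_ _ [p q s t /affineA_comm_neq[st ts st']]|//|u v w _ IH _ IH'] o.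
  rewrite !legal_cat !final_cat; move: (final o p) => o1.
  case/and3P=> -> /and3P[/andP[so pso] /andP[to pto] _] q_legal.
  have tS : ordS s != t by rewrite eq_sym.
  have sS : ordS t != s by rewrite eq_sym.
  have pt : pred t != s by rewrite eq_sym eq_ord_pred.
  have ps : pred s != t by rewrite eq_sym eq_ord_pred.
  have fire_swap : fire (fire o1 t) s = fire (fire o1 s) t.
    apply/setP => i; rewrite !in_fire.
    have [e|_] := eqVneq (ordS i) s.
      have -> : i != t by rewrite -(ordSK i) e.
      by rewrite orbT.
    have [e|_] := eqVneq (ordS i) t.
      have -> : i != s by rewrite -(ordSK i) e.
      by rewrite orbT.
    by rewrite andbCA.
  have to1 : t \in o1 by move: to; rewrite in_fire (negPf sS) => /andP[].
  have pto1 : pred t \notin o1.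
    by move: pto; rewrite in_fire ord_predK eq_sym (negPf st) pt.
  rewrite /final /= fire_swap; split=> //; rewrite /fireable to1 pto1 /=.
  rewrite !in_fire ord_predK (negPf tS) (negPf st) ps so pso /=.
  exact: q_legal.
- by move=> /IH[lv ev] /=; have [lw ew] := IH' _ lv; rewrite ew ev.
Qed.

(** After the move s the site s is empty, and after one more move t either it is
still empty or the site s - 1 is still occupied: s cannot move again. *)
Lemma legal_fc o v : legal o v -> fc_word v.
Proof.
move=> lv u p q s vu.
have [lu _] := legal_comm vu lv.
split=> [def_u|t st def_u]; move: lu; rewrite def_u legal_cat => /andP[_];
  move: (final o p) => o1 /=.
  case/and3P=> [/andP[so pso] /andP[]].
  by rewrite in_fire eqxx (negPf (ordS_neq hn s)).
(* If t = s + 1, the site s is refilled, but so is s - 1 after the first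
   move; if t = s - 1, the site s remains empty. *)
case/and4P=> [/andP[so pso] _ /andP[]].
have Ss := negPf (ordS_neq hn s); have Ps := ord_pred_neq hn s.
case: (affineA_braid st) => [->|def_s].
  have PS : pred s != ordS s by rewrite eq_sym eq_ord_pred ordSS_neq.
  by rewrite !in_fire ord_predK !eqxx (eq_sym s) Ss PS.
by rewrite !in_fire def_s (negPf (ordSS_neq hn t)) eqxx -def_s Ss andbF.
Qed.

(** Among the letters i and i + 1, only i can act first at an occupied site i,
and only i + 1 at an empty one.  When neither letter occurs in v, both indices
are the size of v and the condition holds for either state of the site. *)
Definition compatible o v := forall i,
  if i \in o then index i v <= index (ordS i) v
  else index (ordS i) v <= index i v.

Lemma legal_compatible o v : legal o v -> compatible o v.
Proof.
elim: v o => [|a v IH] o /=; first by move=> _ i; case: ifP.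
case/andP=> /andP[ao pao] /IH cv i; have := cv i; rewrite in_fire /=.
have [e|_] := eqVneq (ordS i) a.
  by move: pao; rewrite -e ordSK => /negPf->.
have [->|ne] := eqVneq i a; first by rewrite ao.
by case: ifP.
Qed.

Lemma legal_start_uniq o o' v : legal o v -> legal o' v -> (forall i, i \in v) ->
  o = o'.
Proof.
move=> /legal_compatible c /legal_compatible c' full; apply/setP => i.
have := c i; have := c' i.
have : index i v != index (ordS i) v.
  apply: contra (ordS_neq hn i) => /eqP e.
  by rewrite -(nth_index i (full (ordS i))) -e nth_index.
case: (i \in o); case: (i \in o') => //= ne le ge;
  by case/negP: ne; rewrite eqn_leq le ge.
Qed.

(** The first letter a of u must occur in v, and no neighbour of a can act before
a does; so the first a of v can be brought to the front by commutations. *)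
Lemma legal_same_counts o u v : legal o u -> legal o v -> perm_eq u v -> comm u v.
Proof.
elim: u v o => [|a u IH] v o /=.
  by move=> _ _; rewrite perm_sym => /perm_nilP->; apply: comm_refl.
case/andP=> fa lu lv uv.
have av : a \in v by rewrite -(perm_mem uv) mem_head.
have cv := legal_compatible lv.
have [p [q [def_v ap]]] : exists p q, v = p ++ a :: q /\ a \notin p
  := first_occurrence av.
have before b : b \in p -> index b v < index a v.
  move=> bp; rewrite def_v !index_cat bp (negPf ap) /= eqxx addn0.
  by rewrite index_mem.
have to_front : comm v (a :: p ++ q).
  apply: comm_sym; rewrite def_v -cat_rcons -cat_cons.
  apply: comm_cat; last exact: comm_refl.
  apply: comm_move => b bp; have := before b bp; case/andP: fa => ao pao lt.
  apply: affineA_neq_comm.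
  - by apply: contra ap => /eqP->.
  - by apply/eqP => def_b; have := cv a; rewrite ao -def_b leqNgt lt.
  - apply/eqP => def_a; have := cv b.
    by move: pao; rewrite def_a ordSK => /negPf->; rewrite -def_a leqNgt lt.
have [/= /andP[_ lpq] _] := legal_comm to_front lv.
apply: comm_trans (comm_sym to_front); apply: comm_cons; apply: IH lu lpq _.
rewrite -(perm_cons a); apply: perm_trans uv _.
exact: comm_perm to_front.
Qed.

Lemma ordS_iter i j : j = iter (n - i + j) (@ordS n) i.
Proof.
have val_iter k : iter k (@ordS n) i = (i + k) %% n :> nat.
  elim: k => [|k IH]; first by rewrite addn0 modn_small.
  by rewrite iterS /= IH -addn1 modnDml addn1 addnS.
apply: ord_inj; rewrite val_iter addnA subnKC; last exact: ltnW.
by rewrite modnDl modn_small.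
Qed.

Lemma ordS_connected (P : {pred 'I_n}) i j :
  (forall k, k \in P -> ordS k \in P) -> i \in P -> j \in P.
Proof.
move=> PS Pi; rewrite (ordS_iter i j).
by elim: (n - i + j) => //= k; apply: PS.
Qed.

Lemma size_sum_count v : size v = \sum_i count_mem i v.
Proof.
elim: v => [|a v IH] /=; first by rewrite big1.
rewrite big_split /= -IH (bigD1 a) //= eqxx big1 // => i.
by rewrite eq_sym => /negPf->.
Qed.

(** By conservation of particles at each site, the difference between the numbers
of letters i in v and in u does not depend on i. *)
Lemma legal_le_count o u v i j : legal o u -> legal o v -> final o u = final o v ->
  count_mem i u < count_mem i v -> count_mem j u < count_mem j v.
Proof.
move=> lu lv ef; apply: (@ordS_connected [pred k | count_mem k u < count_mem k v]).
move=> k; rewrite !inE; have := legal_flux k lu; have := legal_flux k lv.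
by rewrite ef; lia.
Qed.

Lemma legal_same_ends o u v : legal o u -> legal o v -> final o u = final o v ->
  size u = size v -> comm u v.
Proof.
have le u' v' i : legal o u' -> legal o v' -> final o u' = final o v' ->
    size u' = size v' -> count_mem i v' <= count_mem i u'.
  move=> lu lv ef sz; rewrite leqNgt; apply/negP => lt.
  have lt_all j : count_mem j u' < count_mem j v' := legal_le_count j lu lv ef lt.
  suff : size u' < size v' by rewrite sz ltnn.
  rewrite !size_sum_count (bigD1 i) //= [X in _ < X](bigD1 i) //= -addSn.
  apply: leq_add; first exact: lt_all.
  by apply: leq_sum => j _; apply: ltnW.
move=> lu lv ef sz; apply: (legal_same_counts lu lv).
apply/allP => i _ /=; apply/eqP/anti_leq.
by rewrite !le.
Qed.

(** The balance equations force c to be positive on k - 1 when k - 1 and k are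
occupied and c k is positive, and on k + 1 when k is empty and c k is positive.
Starting at i, walk backwards along occupied sites, or forwards along empty
ones: the walk ends at a fireable site, as o is neither full nor empty. *)
Lemma fireable_ex o (c : 'I_n -> nat) f i : o != set0 -> o != setT ->
  (forall k, (k \in o) + c (ordS k) = (k \in f) + c k) -> 0 < c i ->
  exists a, fireable o a && (0 < c a).
Proof.
move=> o0 oT bal ci; apply/existsP; apply: contraT => /existsPn none.
have [j] := set0Pn _ o0; have : ~~ (setT \subset o) by rewrite subTset.
case/subsetPn=> k _ ko jo.
have [io|io] := boolP (i \in o).
  pose A := [pred i | ~~ ((i \in o) && (0 < c i))].
  suff : i \in A by rewrite !inE io ci.
  apply: (@ordS_connected A k); last by rewrite !inE negb_and ko.
  move=> l; rewrite !inE; apply: contra => /andP[So cS].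
  have lo : l \in o.
    by have := none (ordS l); rewrite /fireable ordSK So cS andbT negbK.
  rewrite lo /=; have := bal l; rewrite lo => bal_l.
  by rewrite -(leq_add2l (l \in f)) -bal_l leq_add // leq_b1.
pose A := [pred i | (i \notin o) && (0 < c i)].
suff : j \in A by rewrite !inE jo.
apply: (@ordS_connected A i); last by rewrite !inE io ci.
move=> l; rewrite !inE => /andP[lo cl].
have cS : 0 < c (ordS l).
  by have := bal l; rewrite (negPf lo) add0n => ->; rewrite ltn_addl.
by have := none (ordS l); rewrite /fireable ordSK lo cS !andbT => ->.
Qed.

(** Any solution of the balance equations is realised: fire any available site
that still has letters to spend. *)
Lemma legal_exists o f (c : 'I_n -> nat) : o != set0 -> o != setT ->
  (forall k, (k \in o) + c (ordS k) = (k \in f) + c k) ->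
  exists v, [/\ legal o v, final o v = f & forall i, count_mem i v = c i].
Proof.
have [m] := ubnP (\sum_i c i); elim: m => // m IH in o c * => cm o0 oT bal.
have [/forallP c0|/forallPn[i ci]] := boolP [forall i, c i == 0].
  exists [::]; split=> //= [|i]; last by rewrite (eqP (c0 i)).
  apply/setP => i; have := bal i; rewrite !(eqP (c0 _)).
  by case: (i \in o); case: (i \in f).
rewrite -lt0n in ci; have [a /andP[fa ca]] := fireable_ex o0 oT bal ci.
case/andP: (fa) => ao pao.
have [||||v [lv fv cv]] := IH (fire o a) (fun i => c i - (i == a)).
- rewrite -ltnS; apply: leq_trans cm.
  rewrite ltnS (bigD1 a) //= [X in _ < X](bigD1 a) //= eqxx.
  rewrite (eq_bigr c) => [|j /negPf->]; last by rewrite subn0.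
  by rewrite ltn_add2r subn1 ltn_predL.
- by apply/set0Pn; exists (pred a); rewrite !inE eqxx.
- apply/eqP => eT; have : a \in fire o a by rewrite eT inE.
  by rewrite in_fire (negPf (ordS_neq hn a)) eqxx.
- move=> k; have := bal k; rewrite in_fire.
  have [e|_] := eqVneq (ordS k) a.
    have -> : k == a = false by rewrite -e eq_sym (negPf (ordS_neq hn k)).
    by move: pao; rewrite e -e ordSK e => /negPf->; rewrite subnKC // subn0.
  have [->|_] := eqVneq k a; last by rewrite !subn0.
  rewrite ao /= subn0 add0n => e; apply/eqP; rewrite -(eqn_add2l 1) e.
  by rewrite addnCA subnKC.
exists (a :: v); split=> /= [||i']; rewrite ?fa // cv eq_sym.
by case: eqVneq => [->|_]; rewrite ?subn0 // subnKC.
Qed.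

End Particles.

(** * Fully commutative words are legal *)

Section Legal.
Variables (n : nat) (hn : 2 < n).
Implicit Types (i j s t a b : 'I_n) (o f : {set 'I_n}) (u v w p m q : seq 'I_n).
Local Notation M := (affineA n).
Local Notation comm := (@comm _ M).
Local Notation fc_word := (@fc_word _ M).
Local Notation pred := ord_pred.

Lemma affineA_braidE a b : (M a b == 3) = (b == ordS a) || (a == ordS b).
Proof.
rewrite /= /affineA_m; have [->|_] := eqVneq a b; last by case: (_ || _).
by rewrite [b == _]eq_sym (negPf (ordS_neq hn b)).
Qed.

(** Infinite descent: two letters c between consecutive letters a would, when
chosen consecutive, enclose a strictly shorter gap without a, although a is a
neighbour of c.  So each of the two neighbours of a occurs at most once in the
gap, and together they occur at least twice. *)
Lemma affineA_gap_alternating p a m q b :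
  fc_word (p ++ a :: m ++ a :: q) -> a \notin m -> M a b = 3 -> count_mem b m = 1.
Proof.
have [k] := ubnP (size m); elim: k => // k IH in p a m q b * => mk fv am ab.
have le1 c : M a c = 3 -> count_mem c m <= 1.
  move=> ac; rewrite leqNgt; apply/negP => gt1.
  have [|m1 [r [def_m cm1]]] := @first_occurrence _ c m.
    by rewrite -has_pred1 has_count; apply: ltnW.
  move: gt1; rewrite def_m count_cat /= eqxx (count_memPn cm1) add1n ltnS => cr.
  have [|m' [m2 [def_r cm']]] := @first_occurrence _ c r.
    by rewrite -has_pred1 has_count.
  subst r m; have : count_mem a m' = 1.
    apply: (IH (p ++ a :: m1) c m' (m2 ++ a :: q)) => //.
    - by move: mk; rewrite !size_cat /= size_cat; lia.
    - by move: fv; rewrite -!(catA, cat_cons).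
    - by rewrite cox_mC.
  suff /count_memPn-> : a \notin m' by [].
  by apply: contra am => am'; rewrite !(mem_cat, inE) am' !orbT.
have := fc_word_gap (@affineA_simply_laced n) fv am.
have -> : count [pred c | M a c == 3] m =
    count_mem (ordS a) m + count_mem (pred a) m.
  rewrite -count_predUI [X in _ + X](_ : _ = 0) ?addn0.
    by apply: eq_count => c /=; rewrite affineA_braidE [a == _]eq_sym eq_ord_pred.
  rewrite (eq_count (a2 := pred0)) ?count_pred0 // => c /=.
  apply/andP => -[/eqP-> ]; rewrite eq_ord_pred; exact/negP/ordSS_neq.
have leS : count_mem (ordS a) m <= 1.
  by apply/le1/eqP; rewrite affineA_braidE eqxx.
have leP : count_mem (pred a) m <= 1.
  by apply/le1/eqP; rewrite affineA_braidE ord_predK eqxx orbT.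
move/eqP: ab; rewrite affineA_braidE [a == _]eq_sym -eq_ord_pred.
by case/orP => /eqP->; move: leS leP; lia.
Qed.

(** The default value of [index] covers the case in which a does not occur in v. *)
Lemma fc_word_next a b v : fc_word (a :: v) -> M a b = 3 ->
  index b v <= index a v.
Proof.
move=> fv ab; have [av|/memNindex->] := boolP (a \in v); last exact: index_size.
have [m [q [def_v am]]] := first_occurrence av; subst v.
have bm : b \in m.
  by rewrite -has_pred1 has_count (@affineA_gap_alternating [::] a m q).
by rewrite !index_cat bm (negPf am) /= eqxx addn0 ltnW ?index_mem.
Qed.

Lemma fc_word_legal o v : fc_word v -> compatible o v -> legal o v.
Proof.
elim: v o => //= a v IH o fv cv.
have fv' : fc_word v := @fc_word_suffix _ M [:: a] v fv.
have aS : M a (ordS a) = 3 by apply/eqP; rewrite affineA_braidE eqxx.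
have aP : M a (pred a) = 3 by apply/eqP; rewrite affineA_braidE ord_predK eqxx orbT.
have Sa : a == ordS a = false by rewrite eq_sym (negPf (ordS_neq hn a)).
have ao : a \in o.
  by apply: contraT => ao; have := cv a; rewrite (negPf ao) /= eqxx Sa.
have pao : pred a \notin o.
  apply/negP => pao; have := cv (pred a); rewrite pao ord_predK /= eqxx.
  by rewrite eq_sym (negPf (ord_pred_neq hn a)).
rewrite /fireable ao pao /=; apply: IH => // i; rewrite in_fire.
have [e|nSi] := eqVneq (ordS i) a.
  have -> : i = pred a by rewrite -e ordSK.
  by rewrite ord_predK /=; exact: fc_word_next fv aP.
have [->|ni] := eqVneq i a; first exact: fc_word_next fv aS.
by have := cv i; rewrite /= ![a == _]eq_sym (negPf nSi) (negPf ni).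
Qed.

Lemma fc_word_legal_ex v : fc_word v -> exists o, legal o v.
Proof.
move=> fv; exists [set i | index i v < index (ordS i) v].
apply: fc_word_legal => // i; rewrite inE; case: leqP => //.
exact: ltnW.
Qed.

End Legal.

(** * Counting long fully commutative elements *)

Lemma card_fset_set_image (T : finType) (U : choiceType)
    (A : classical_sets.set U) (X : {set T}) (g : T -> U) :
  cardinality.finite_set A -> {in X &, injective g} ->
  (forall y, A y <-> exists2 x, x \in X & g x = y) ->
  #|` cardinality.fset_set A|%fset = #|X|.
Proof.
move=> finA inj_g imA; rewrite cardE -(size_map g); apply: perm_size.
apply: uniq_perm; first exact: fset_uniq.
  by rewrite map_inj_in_uniq ?enum_uniq // => x y; rewrite !mem_enum; apply: inj_g.
move=> y; rewrite cardinality.in_fset_set //; apply/idP/mapP.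
  rewrite classical_sets.in_setE => /imA[x xX <-]; exists x; rewrite ?mem_enum //.
case=> x; rewrite mem_enum => xX ->.
by rewrite classical_sets.in_setE imA; exists x.
Qed.

Section Count.
Variables (n : nat) (hn : 2 < n).
Implicit Types (i j s t a b : 'I_n) (o f : {set 'I_n}) (u v w p m q : seq 'I_n).
Local Notation M := (affineA n).
Local Notation comm := (@comm _ M).
Local Notation fc_word := (@fc_word _ M).
Local Notation pred := ord_pred.

(** The possible initial and final states of nonempty legal words; a full or
empty ring admits no move. *)
Definition end_pairs : {set {set 'I_n} * {set 'I_n}} :=
  [set x : {set 'I_n} * {set 'I_n} |
    [&& x.1 != set0, x.1 != setT & #|x.1| == #|x.2|]].

Definition end_pairs_at l :=
  [set x in end_pairs | l + position_sum x.2 == position_sum x.1 %[mod n]].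

(** Without the conditions on x.1 the count is the sum of the squares of the
binomial coefficients 'C(n, k); the two excluded pairs are those of the empty
and of the full ring. *)
Lemma card_end_pairs : #|end_pairs| + 2 = 'C(2 * n, n).
Proof.
pose all_pairs := [set x : {set 'I_n} * {set 'I_n} | #|x.1| == #|x.2|].
have card_all : #|all_pairs| = 'C(2 * n, n).
  transitivity (\sum_(o : {set 'I_n}) \sum_(f : {set 'I_n} | #|o| == #|f|) 1).
    rewrite pair_big_dep /= sum1dep_card; apply: eq_card => -[o f].
    by rewrite !inE.
  rewrite mul2n -addnn -binomial.Vandermonde.
  have card_f o : \sum_(f : {set 'I_n} | #|o| == #|f|) 1 = 'C(n, #|o|).
    rewrite sum1dep_card -[X in 'C(X, _)](card_ord n) -card_draws.
    by apply: eq_card => f; rewrite !inE eq_sym.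
  rewrite (eq_bigr _ (fun o _ => card_f o)).
  have le_o o : #|o| < n.+1 by rewrite ltnS -[n in _ <= n]card_ord max_card.
  rewrite (partition_big (fun o => Ordinal (le_o o)) xpredT) //=.
  apply: eq_bigr => k _.
  rewrite (eq_bigr (fun=> 'C(n, k))) => [|o /eqP<- //].
  rewrite sum_nat_const bin_sub -1?ltnS //; congr (_ * _).
  have := card_draws 'I_n k; rewrite card_ord => <-.
  by apply: eq_card => o; rewrite !inE.
have -> : end_pairs = all_pairs :\: [set (set0, set0); (setT, setT)].
  apply/setP => -[o f]; rewrite !inE /= !xpair_eqE negb_or andbA.
  have [eof|_] := eqVneq #|o| #|f|; last by rewrite !andbF.
  rewrite !andbT; congr (_ && _).
    congr (~~ _); have [o0|//] := eqVneq o set0.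
    by move: eof; rewrite o0 cards0 => /esym/cards0_eq->; rewrite eqxx.
  congr (~~ _); have [oT|//] := eqVneq o setT.
  move: eof; rewrite oT cardsT => /esym fT.
  by rewrite eqEcard subsetT cardsT fT leqnn.
rewrite -card_all -(cardsID [set (set0, set0); (setT, setT)] all_pairs) addnC.
congr (_ + _); rewrite (setIidPr _).
  rewrite cards2 xpair_eqE andbb; case: eqP => //.
  by move/setP/(_ (Ordinal (ltnW (ltnW hn)))); rewrite !inE.
apply/subsetP => -[o f]; rewrite !inE !xpair_eqE.
by case/orP => /andP[/eqP-> /eqP->].
Qed.

(** By conservation at each site, going from i to i + 1 increases the number of
occurrences by at most 1; so a missing letter bounds the length. *)
Lemma legal_full o v i : legal o v -> 2 * n ^ 2 < size v -> i \in v.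
Proof.
move=> lv; apply: contraLR => iv; rewrite -leqNgt size_sum_count.
have le k : count_mem (iter k (@ordS n) i) v <= k.
  elim: k => [|k IH]; first by rewrite (count_memPn iv).
  set j := iter k _ i in IH *; rewrite [iter _ _ _]/=.
  apply: leq_trans (leq_addl (j \in o) _) _; rewrite legal_flux //.
  by rewrite -add1n leq_add // leq_b1.
apply: (@leq_trans (\sum_(j < n) 2 * n)).
  apply: leq_sum => j _; rewrite (ordS_iter i j); apply: leq_trans (le _) _.
  by have := ltn_ord j; lia.
by rewrite sum_nat_const card_ord; lia.
Qed.

(** The solutions of the balance equations are determined up to a constant K by
the partial sums of f minus those of o, and n is added to stay in the natural
numbers.  Increasing K by 1 increases the length by n, and the residue of the
length modulo n is already the right one. *)
Lemma legal_of_length o f l : (o, f) \in end_pairs_at l -> 2 * n ^ 2 <= l ->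
  exists v, [/\ legal o v, final o v = f & size v = l].
Proof.
rewrite !inE /= => /andP[/and3P[o0 oT /eqP card_of] /eqP eq_pos] le_l.
pose below (x : {set 'I_n}) k := #|[set j in x | j < k]|.
have below_le x k : below x k <= n.
  by rewrite -[n in _ <= n]card_ord max_card.
have below0 x : below x 0 = 0 by apply: eq_card0 => j; rewrite !inE andbF.
have belown x : below x n = #|x| by apply: eq_card => j; rewrite !inE ltn_ord andbT.
have belowS x i : below x i.+1 = (i \in x) + below x i.
  rewrite /below (cardsD1 i) !inE ltnS leqnn andbT; congr (_ + _).
  by apply: eq_card => j; rewrite !inE ltnS ltn_neqAle andbCA.
pose c K (i : 'I_n) := K + (n + below f i - below o i).
have bal K k : (k \in o) + c K (ordS k) = (k \in f) + c K k.
  have -> : c K (ordS k) = K + (n + below f k.+1 - below o k.+1).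
    (* Passing from the site n - 1 to 0 is harmless since |o| = |f|. *)
    rewrite /c val_ordS; case: eqP => // ->.
    by rewrite !below0 !belown card_of addn0 subn0 addnK.
  rewrite /c; have := below_le o k; have := below_le o k.+1; rewrite !belowS.
  by case: (_ \in o); case: (_ \in f); lia.
have words K := legal_exists hn o0 oT (bal K).
pose C := \sum_i c 0 i.
have sizes K v : (forall i, count_mem i v = c K i) -> size v = n * K + C.
  move=> cv; rewrite size_sum_count (eq_bigr _ (fun i _ => cv i)).
  by rewrite /c big_split /= sum_nat_const card_ord /C /c; congr (_ + _).
have le_C : C <= l.
  apply: leq_trans le_l; apply: (@leq_trans (\sum_(j < n) 2 * n)).
    apply: leq_sum => j _.
    by have := below_le f j; rewrite /c; lia.
  by rewrite sum_nat_const card_ord; lia.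
have n_dvd : n %| l - C.
  rewrite -eqn_mod_dvd //; have [v [lv fv cv]] := words 0.
  have := legal_position_sum lv.
  rewrite fv (sizes _ _ cv) muln0 add0n -eq_pos => /eqP.
  by rewrite eqn_modDr eq_sym.
have [v [lv fv cv]] := words ((l - C) %/ n); exists v; split=> //.
by rewrite (sizes _ _ cv) mulnC divnK // subnK.
Qed.

Lemma fc_count_large l : 2 * n ^ 2 < l -> fc_count M l = #|end_pairs_at l|.
Proof.
move=> large.
pose spec (x : {set 'I_n} * {set 'I_n}) v :=
  x \in end_pairs_at l -> [/\ legal x.1 v, final x.1 v = x.2 & size v = l].
have [x|g gP] := @choice _ _ spec.
  have [|x_out] := boolP (x \in end_pairs_at l).
    rewrite {1}[x]surjective_pairing => /legal_of_length/(_ (ltnW large))[v vP].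
    by exists v.
  by exists [::] => x_in; rewrite x_in in x_out.
have gfc x : x \in end_pairs_at l -> fc_word (g x).
  by case/gP => lg _ _; apply: legal_fc lg.
have fc_comm v u : fc_word v -> cox_word M u = cox_word M v -> size u = size v ->
    comm u v.
  move=> fv uv suv; apply: (fc_word_unique _ _ fv uv); last by rewrite suv.
    exact: affineA_simply_laced.
  exact: affineA_gen_inj.
have fc_len v : fc_word v -> cox_length (cox_word M v) = size v.
  exact: (fc_word_length (@affineA_simply_laced n) (affineA_gen_inj hn)).
apply: (card_fset_set_image (g := fun x => cox_word M (g x))).
- exact: finite_fc_elements.
- move=> x y xX yX /(fc_comm _ _ (gfc y yX)) gxy.
  have [lx fx sx] := gP x xX; have [ly fy sy] := gP y yX.
  have {}gxy : comm (g x) (g y) by apply: gxy; rewrite sx sy.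
  have [lxy fxy] := legal_comm gxy lx.
  have e1 : x.1 = y.1.
    by apply: (legal_start_uniq hn lxy ly) => i; apply: legal_full ly _; rewrite sy.
  have e2 : x.2 = y.2 by rewrite -fx -fy -fxy e1.
  by rewrite (surjective_pairing x) (surjective_pairing y) e1 e2.
move=> w; split=> [[fcw lw]|[x xX <-]]; last first.
  have [lx fx sx] := gP x xX; split; last by rewrite (fc_len _ (gfc x xX)).
  exact: (fc_word_fc (@affineA_simply_laced n) (affineA_gen_inj hn) (gfc x xX)).
have [v [vw sv]] := cox_reduced_ex w.
have fv : fc_word v by apply: (fc_word_of_reduced fcw); split.
have [o lv] := fc_word_legal_ex hn fv.
have xX : (o, final o v) \in end_pairs_at l.
  rewrite !inE /= legal_card // eqxx andbT -lw -sv; apply/andP; split; last first.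
    by rewrite legal_position_sum.
  move: lv; rewrite -lw -sv in large; case: v large {vw sv fv} => // a v _ /=.
  case/andP=> /andP[ao pao] _; apply/andP; split; first by apply/set0Pn; exists a.
  by apply: contraNneq pao => ->; rewrite inE.
exists (o, final o v) => //; rewrite -vw; apply: comm_word.
have [/= lg fg sg] := gP _ xX.
by apply: (legal_same_ends hn lg lv fg); rewrite sg sv.
Qed.

End Count.

(** * Mean values *)

Lemma periodic_window (a : nat -> nat) N p k : periodic_from a N p ->
  \sum_(N + k <= l < N + k + p) a l = \sum_(N <= l < N + p) a l.
Proof.
case=> p0 per; elim: k => [|k <-]; first by rewrite addn0.
rewrite addnS; apply: (@addnI (a (N + k))).
rewrite -big_ltn ?addSn; last by rewrite ltnS leq_addr.
rewrite big_nat_recr ?leq_addr //= addnC; congr (_ + _).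
by rewrite per // leq_addr.
Qed.

Lemma periodic_windows (a : nat -> nat) N p k : periodic_from a N p ->
  \sum_(N <= l < N + k * p) a l = k * \sum_(N <= l < N + p) a l.
Proof.
move=> per; elim: k => [|k IH]; first by rewrite addn0 big_geq.
rewrite (@big_cat_nat _ _ _ (N + k * p)) ?leq_addr ?leq_add2l ?leq_mul //=.
by rewrite IH mulSn addnC [p + _]addnC addnA periodic_window.
Qed.

(** Two periods p and p' give the same mean: compare both with the sum over a
common window of length p * p'. *)
Lemma has_mean_value_window (a : nat -> nat) N p : periodic_from a N p ->
  has_mean_value a ((\sum_(N <= l < N + p) a l)%N%:R / p%:R)%R.
Proof.
move=> per; split; first by exists N, p.
move=> N' p' per'.
have eqT : p * \sum_(N' <= l < N' + p') a l = p' * \sum_(N <= l < N + p) a l.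
  have far_per q r m : periodic_from a q r -> periodic_from a (q + m) r.
    by case=> r0 e; split=> // l le; apply: e; apply: leq_trans le; apply: leq_addr.
  rewrite -(periodic_window N' per) -(periodic_window N per') (addnC N').
  have perM' : periodic_from a (N + N') p' by rewrite addnC; apply: far_per.
  have perM : periodic_from a (N + N') p by apply: far_per.
  by rewrite -(periodic_windows p perM') -(periodic_windows p' perM) mulnC.
have [[p0 _] [p0' _]] := (per, per').
apply/eqP; rewrite GRing.eqr_div ?Num.Theory.pnatr_eq0 -?lt0n //.
by rewrite -!GRing.natrM Num.Theory.eqr_nat mulnC eqT mulnC.
Qed.

Lemma sum_window_residue n N b a : 0 < n ->
  \sum_(N <= l < N + n) (l + b == a %[mod n]) = 1.
Proof.
move=> n0; pose h l : nat := l == a %[mod n].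
have per : periodic_from h 0 n by split=> // l _; rewrite /h modnDr.
transitivity (\sum_(N + b <= l < N + b + n) h l).
  by rewrite [N + b + n]addnAC big_addn addnK.
rewrite -[N + b]add0n periodic_window // add0n big_mkord.
rewrite (bigD1 (Ordinal (ltn_pmod a n0))) //= /h modn_mod eqxx big1 // => i.
by rewrite -val_eqE /= (modn_small (ltn_ord i)) => /negPf->.
Qed.

Lemma sum_end_pairs_at n N : 0 < n ->
  \sum_(N <= l < N + n) #|end_pairs_at n l| = #|end_pairs n|.
Proof.
move=> n0.
rewrite (eq_bigr (fun l => \sum_(x in end_pairs n)
    (l + position_sum x.2 == position_sum x.1 %[mod n]))) => [|l _].
  rewrite exchange_big /= -sum1_card; apply: eq_bigr => x _.
  exact: sum_window_residue.
rewrite -sum1_card big_mkcond [RHS]big_mkcond; apply: eq_bigr => x _.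
by rewrite [x \in end_pairs_at _ _]inE; case: (x \in _) => //=; case: (_ == _).
Qed.

Theorem proposition2p6 (n : nat) (hn : 3 <= n) :
  has_mean_value (fc_count (affineA n))
    ((n%:R)^-1 * ('C(2 * n, n)%:R - 2%:R))%R.
Proof.
have n0 : 0 < n by apply: ltnW (ltnW hn).
pose N := (2 * n ^ 2).+1.
have per : periodic_from (fc_count (affineA n)) N n.
  split=> // l le; rewrite !fc_count_large //; last by rewrite ltn_addr.
  by apply: eq_card => x; rewrite !inE addnAC modnDr.
have := has_mean_value_window per.
rewrite (eq_big_nat _ _ (F2 := fun l => #|end_pairs_at n l|)) => [|l /andP[le _]].
  rewrite sum_end_pairs_at // -(card_end_pairs hn) GRing.natrD GRing.addrK.
  by rewrite GRing.mulrC.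
exact: fc_count_large.
Qed.
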